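(* Let $X_n$ be a nonempty ULC metric space for each $n\in\mathbb{N}$ and let $X=\prod_{n} X_n$. (a) $X$ is ULC if and only if all but finitely many of the $X_n$ are connected. (b) The following are equivalent: (b$_1$) $X$ is straight; (b$_2$) either $X$ is ULC or each $X_n$ is precompact.
   Context: All spaces are metric. A metric space $X$ is straight if whenever $X$ is the union of finitely many closed sets, a continuous function $f\colon X\to\mathbb{R}$ is uniformly continuous if and only if its restriction to each of these closed sets is uniformly continuous. A metric space $X$ is uniformly locally connected (ULC) if for every $\varepsilon>0$ there is $\delta>0$ such that any two points of $X$ at distance $<\delta$ lie in a connected subset of $X$ of diameter $<\varepsilon$. Precompact means totally bounded (equivalently, the metric completion is compact). Metrics are assumed to be bounded by $1$ (only uniform properties matter), and a countably infinite product $\prod_n X_n$ of metric spaces $(X_n,d_n)$ carries the metric $d(x,y)=\sum_n \frac{1}{2^n}d_n(x_n,y_n)$. *)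

(* Defs.v *)
From HB Require Import structures.
From mathcomp Require Import all_boot all_order all_algebra.
From mathcomp Require Import all_classical all_reals all_analysis.

Set Implicit Arguments.
Unset Strict Implicit.
Unset Printing Implicit Defensive.

Import Order.TTheory GRing.Theory Num.Theory.
Import numFieldNormedType.Exports.

Local Open Scope classical_set_scope.
Local Open Scope ring_scope.

(* [sigL A f] is the restriction of [f] to the subtype [A], which carries the
   uniform structure induced by the metric of [X]. *)
Definition straight (R : realType) (X : metricType R) : Prop :=
  forall (k : nat) (C : 'I_k -> set X),
    (forall i, closed (C i)) -> \bigcup_i C i = [set: X] ->
  forall f : X -> R, continuous f ->
    (unif_continuous f <-> forall i, unif_continuous (sigL (C i) f)).

Definition diameter (R : realType) (X : metricType R) (A : set X) : \bar R :=
  ereal_sup [set (mdist z.1 z.2)%:E | z in A `*` A].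

Definition ulc (R : realType) (X : metricType R) : Prop :=
  forall e : R, 0 < e -> exists2 d : R, 0 < d &
    forall x y : X, mdist x y < d ->
      exists A : set X, [/\ connected A, A x, A y & (diameter A < e%:E)%E].

Definition totally_bounded (R : realType) (X : metricType R) : Prop :=
  forall e : R, 0 < e ->
    exists2 F : set X, finite_set F & \bigcup_(x in F) ball x e = [set: X].

(* The bound is a parameter of the type, as it makes the series defining the
   product metric converge.  The bare dependent product would carry the
   library's product topology, hence the type alias. *)
Definition metric_prod (R : realType) (X : nat -> metricType R)
  (X1 : forall n (x y : X n), mdist x y <= 1) : Type := forall n, X n.

Section metric_prod.
Context (R : realType) (X : nat -> metricType R).
Variable X1 : forall n (x y : X n), mdist x y <= 1.
Local Notation P := (metric_prod X1).
Implicit Types x y z : P.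

Let term x y (n : nat) : R := 2^-1 ^+ n * mdist (x n) (y n).

Definition prod_mdist x y : R :=
  limn (series (fun n => 2^-1 ^+ n * mdist (x n) (y n))).

Let term_ge0 x y n : 0 <= term x y n.
Proof. by rewrite mulr_ge0 ?mdist_ge0// exprn_ge0. Qed.

Lemma is_cvg_prod_mdist x y :
  cvgn (series (fun n => 2^-1 ^+ n * mdist (x n) (y n))).
Proof.
apply: (@series_le_cvg _ _ (geometric 1 2^-1)).
- exact: term_ge0.
- by move=> n; rewrite /geometric/= mul1r exprn_ge0.
- by move=> n; rewrite /geometric/= mul1r ler_piMr ?exprn_ge0.
- by apply: is_cvg_geometric_series; rewrite ger0_norm// invf_lt1// ltr1n.
Qed.

Let prod_mdistxx x : prod_mdist x x = 0.
Proof.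
rewrite /prod_mdist (_ : series _ = fun=> 0) ?lim_cst//.
by apply/funext => n; rewrite /series/= big1// => i _; rewrite mdistxx mulr0.
Qed.

Let prod_mdist_positivity x y : prod_mdist x y = 0 -> x = y.
Proof.
move=> xy0; apply: functional_extensionality_dep => n.
apply: mdist_positivity; apply/eqP; rewrite eq_le mdist_ge0 andbT.
suff : term x y n <= 0 by rewrite pmulr_rle0// exprn_gt0.
rewrite -xy0; apply: (@le_trans _ _ (series (term x y) n.+1)).
  by rewrite /series/= big_nat_recr//= lerDr sumr_ge0// => i _; exact: term_ge0.
apply: nondecreasing_cvgn_le; last exact: is_cvg_prod_mdist.
by apply/nondecreasing_seqP => m; rewrite /series/= big_nat_recr//= lerDl term_ge0.
Qed.

Let prod_mdist_sym x y : prod_mdist x y = prod_mdist y x.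
Proof.
rewrite /prod_mdist; congr (limn (series _)).
by apply/funext => n; rewrite metric_sym.
Qed.

Let prod_mdist_triangle y x z :
  prod_mdist x z <= prod_mdist x y + prod_mdist y z.
Proof.
rewrite /prod_mdist -limD; [|exact: is_cvg_prod_mdist..].
apply: ler_lim; first exact: is_cvg_prod_mdist.
  by apply: is_cvgD; exact: is_cvg_prod_mdist.
apply: nearW => n; rewrite [leRHS]/= -[leRHS]big_split/=; apply: ler_sum => i _.
by rewrite -mulrDr ler_wpM2l ?exprn_ge0// metric_triangle.
Qed.

HB.instance Definition _ := gen_eqMixin P.
HB.instance Definition _ := gen_choiceMixin P.
HB.instance Definition _ := isMetric.Build R P prod_mdistxx
  prod_mdist_positivity prod_mdist_sym prod_mdist_triangle.

Lemma mdist_prodE x y :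
  mdist x y = limn (series (fun n => 2^-1 ^+ n * mdist (x n) (y n))).
Proof. by []. Qed.

End metric_prod.

(* Main.v *)
Require Import Defs.
From mathcomp Require Import all_boot all_order all_algebra.
From mathcomp Require Import all_classical all_reals all_analysis.
From mathcomp Require Import finmap lra.

Set Implicit Arguments.
Unset Strict Implicit.
Unset Printing Implicit Defensive.

Import Order.TTheory GRing.Theory Num.Theory.
Import numFieldNormedType.Exports.

Local Open Scope classical_set_scope.
Local Open Scope ring_scope.

(** Why the theorem holds.

(a) A point of the product is controlled by finitely many coordinates up to a
tail of total weight [2 * 2^-N].  If [X n] is connected for all large [n],
nearby points lie in a common box whose large-index sides are whole spaces and
whose other sides are small connected sets; such a box is connected
([connected_box]) and small ([prod_ulc_box]).  Conversely, moving the single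
coordinate [n] arbitrarily costs at most [2^-n], so uniform local connectedness
of the product joins any two points of [X n] by a connected set once [n] is
large ([ulc_prod_connected]).

(b) The engine for straightness is [piecewise_small_osc]: if [f] is continuous
and uniformly continuous on each of [k] closed sets covering the space, then
[f] varies little on every connected set of small diameter, because the image
is an interval covered by [k] short sets.  Hence locally connected in the
uniform sense implies straight.

When every factor is totally bounded, suppose that [f] fails to be uniformly
continuous.  An ultrafilter of pairs witnessing the failure is Cauchy in each
coordinate; picking [q n] close to its [n]-th coordinate gives an actual point
[q] of the product, although the ultrafilter itself need not converge.
A pair [(x, y)] of the ultrafilter has both members coordinatewise close to [q]
for [n < M].  Replacing the first [M] coordinates of [x] by those of [q] gives
a point that is close to [q], where continuity of [f] at [q] applies, and that
lies in a common small connected box with [x].  So [f x], and likewise [f y], is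
close to [f q], a contradiction ([totally_bounded_straight_prod]).

If infinitely many factors are disconnected and [X n0] has an infinite
uniformly separated sequence [a], pair [a j] with a clopen splitting of some
factor of index larger than [j] and [n0].  Near the slice where the [n0]-th
coordinate is [a j], one function follows the distance to [a j] on one side of
the splitting and stays constant on the other.  It is uniformly continuous on
each of two closed sets, but takes values a fixed distance apart at points that
are arbitrarily close ([not_straight_prod]). *)

(** * Uniform continuity, diameter and connectedness in metric spaces *)

Section metric_spaces.
Context {R : realType}.
Implicit Types (X : metricType R) (e d : R).

Lemma continuous_metric X (Y : metricType R) (f : X -> Y) :
  (forall x e, 0 < e -> exists2 d, 0 < d &
    forall y, mdist x y < d -> mdist (f x) (f y) < e) -> continuous f.
Proof.
move=> cf x; apply/cvg_ballP => e e0; apply/nbhs_ballP.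
have [d d0 fd] := cf x e e0.
by exists d => // y; rewrite !ballEmdist; exact: fd.
Qed.

Lemma unif_continuous_metricP X (f : X -> R) :
  unif_continuous f <->
  forall e, 0 < e -> exists2 d, 0 < d &
    forall x y, mdist x y < d -> `|f x - f y| < e.
Proof.
split=> [/unif_continuousP uf e e0|uf].
  have [d d0 fd] := uf e e0; exists d => // x y xy.
  by apply: (fd (x, y)); rewrite /= ballEmdist.
apply/unif_continuousP => e e0; have [d d0 fd] := uf e e0.
by exists d => // -[x y]/=; rewrite ballEmdist => /fd.
Qed.

Lemma unif_continuous_sigLP X (C : set X) (f : X -> R) :
  unif_continuous (sigL C f) <->
  forall e, 0 < e -> exists2 d, 0 < d &
    forall x y, C x -> C y -> mdist x y < d -> `|f x - f y| < e.
Proof.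
split=> [/unif_continuousP uf e e0|uf].
  have [d d0 fd] := uf e e0; exists d => // x y Cx Cy xy.
  apply: (fd (SigSub (mem_set Cx), SigSub (mem_set Cy))).
  by rewrite /= -initial_ballE/= ballEmdist.
apply/unif_continuousP => e e0; have [d d0 fd] := uf e e0.
exists d => // -[x y]/=; rewrite -initial_ballE/= ballEmdist => /fd; apply.
  exact: set_valP.
exact: set_valP.
Qed.

Lemma unif_continuous_sigL X (C : set X) (f : X -> R) :
  unif_continuous f -> unif_continuous (sigL C f).
Proof.
move=> /unif_continuous_metricP uf; apply/unif_continuous_sigLP => e e0.
by have [d d0 fd] := uf e e0; exists d => // x y _ _; exact: fd.
Qed.

Lemma unif_continuous_sigL_within X (C : set X) (f : X -> R) :
  unif_continuous (sigL C f) -> {within C, continuous f}.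
Proof.
move=> /unif_continuous_sigLP uf; apply/subspace_continuousP => x Cx.
apply/cvg_ballP => e e0; have [d d0 fd] := uf e e0.
apply/nbhs_ballP; exists d => //= y; rewrite ballEmdist => xy Cy.
exact: fd.
Qed.

Lemma diameter_lt X (A : set X) e x y :
  (diameter A < e%:E)%E -> A x -> A y -> mdist x y < e.
Proof.
move=> Ae Ax Ay; rewrite -lte_fin; apply: le_lt_trans Ae.
by apply: ereal_sup_ubound; exists (x, y).
Qed.

Lemma diameter_le X (A : set X) e :
  (forall x y, A x -> A y -> mdist x y <= e) -> (diameter A <= e%:E)%E.
Proof.
by move=> Ae; apply: ge_ereal_sup => _ [[x y] [/= Ax Ay] <-];
   rewrite lee_fin Ae.
Qed.

Lemma ulcP X : ulc X -> forall e, 0 < e -> exists2 d, 0 < d &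
  forall x y, mdist x y < d -> exists A : set X,
    [/\ connected A, A x, A y & forall u v, A u -> A v -> mdist u v < e].
Proof.
move=> uX e e0; have [d d0 Xd] := uX e e0.
exists d => // x y /Xd[A [cA Ax Ay Ae]].
by exists A; split=> // u v; exact: diameter_lt.
Qed.

(** The image of [A] is an interval covered by [k] sets of diameter at most [b]:
    if it were longer than [b * k], then [k + 1] equally spaced values would be
    more than [b] apart, while two of them come from the same [C i]. *)
Lemma connected_osc (T : topologicalType) (k : nat) (C : 'I_k -> set T)
    (A : set T) (f : T -> R) (b : R) :
  connected A -> continuous f -> \bigcup_i C i = [set: T] ->
  (forall i x y, A x -> A y -> C i x -> C i y -> `|f x - f y| <= b) ->
  forall x y, A x -> A y -> `|f x - f y| <= b * k%:R.
Proof.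
move=> cA cf CT fb.
have main x y : A x -> A y -> f x <= f y -> f y - f x <= b * k%:R.
  move=> Ax Ay xy; set L := f y - f x.
  have k0 : (0 < k%:R :> R).
    have [i _ _] : (\bigcup_i C i) x by rewrite CT.
    by rewrite ltr0n (leq_ltn_trans _ (ltn_ord i)).
  have L0 : 0 <= L by rewrite subr_ge0.
  pose t (j : 'I_k.+1) := f x + j%:R * (L / k%:R).
  have /connected_intervalP fA : connected (f @` A).
    by apply: connected_continuous_connected => //; exact: continuous_subspaceT.
  have zP j : exists z, A z /\ f z = t j.
    suff [z Az fz] : (f @` A) (t j) by exists z.
    apply: (fA (f x) (f y)); [by exists x|by exists y|].
    rewrite /t lerDl mulr_ge0 ?divr_ge0 ?(ltW k0)//=.
    rewrite -lerBrDl -/L mulrCA ler_piMr// ler_pdivrMr// mul1r ler_nat.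
    by rewrite -ltnS.
  have [z {}zP] := choice zP.
  have iP j : exists i, C i (z j).
    have [i _ Ci] : (\bigcup_i C i) (z j) by rewrite CT.
    by exists i.
  have [g gP] := choice iP.
  have /injectivePn[i [j ij gij]] : ~~ injectiveb g.
    by apply/injectiveP => /leq_card; rewrite !card_ord ltnn.
  have := fb (g i) (z i) (z j) (zP i).1 (zP j).1 (gP i).
  rewrite gij => /(_ (gP j)); rewrite (zP i).2 (zP j).2 /t.
  rewrite [f x + _]addrC addrKA -mulrBl normrM.
  rewrite (ger0_norm (divr_ge0 L0 (ltW k0))) => Lb.
  rewrite -ler_pdivrMr//; apply: le_trans Lb; apply: ler_peMl.
    by rewrite divr_ge0// ltW.
  have natB (m n : nat) : (m < n)%N -> 1 <= `|m%:R - n%:R| :> R.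
    by move=> mn; rewrite distrC -natrB 1?ltnW// normr_nat ler1n subn_gt0.
  by move: ij; rewrite -val_eqE neq_ltn => /orP[/natB//|/natB]; rewrite distrC.
move=> x y Ax Ay; have [xy|yx] := leP (f x) (f y).
  by rewrite distrC ger0_norm ?subr_ge0// main.
by rewrite ger0_norm ?subr_ge0 ?(ltW yx)// main// ltW.
Qed.

Lemma piecewise_small_osc X (k : nat) (C : 'I_k -> set X) (f : X -> R) :
  continuous f -> \bigcup_i C i = [set: X] ->
  (forall i, unif_continuous (sigL (C i) f)) ->
  forall e, 0 < e -> exists2 d, 0 < d &
    forall A, connected A -> (forall u v, A u -> A v -> mdist u v < d) ->
      forall x y, A x -> A y -> `|f x - f y| <= e.
Proof.
move=> cf CX uf e e0.
have ek0 : 0 < e / k.+1%:R by rewrite divr_gt0.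
have dP i : exists d, 0 < d /\
    forall x y, C i x -> C i y -> mdist x y < d -> `|f x - f y| < e / k.+1%:R.
  have /unif_continuous_sigLP/(_ _ ek0)[d d0 fd] := uf i.
  by exists d.
have [d {}dP] := choice dP.
exists (\big[Order.min/1]_i d i).
  by apply: lt_bigmin => // i _; exact: (dP i).1.
move=> A cA Ad x y Ax Ay.
apply: (@le_trans _ _ (e / k.+1%:R * k%:R)).
  apply: (connected_osc cA cf CX) => // i u v Au Av Cu Cv; apply/ltW.
  by apply: (dP i).2 => //; apply: (lt_le_trans (Ad _ _ Au Av));
    exact: bigmin_le_cond.
by rewrite mulrAC ler_pdivrMr// ler_wpM2l ?ltW// ltr_nat.
Qed.

Lemma ulc_straight X : ulc X -> straight X.
Proof.
move=> /ulcP uX k C _ CX f cf.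
split=> [uf i|uf]; first exact: unif_continuous_sigL.
apply/unif_continuous_metricP => e e0.
have e20 : 0 < e / 2 by rewrite divr_gt0.
have [h h0 fh] := piecewise_small_osc cf CX uf e20.
have [d d0 Xd] := uX _ h0; exists d => // x y /Xd[A [cA Ax Ay Ah]].
apply: (le_lt_trans (fh A cA Ah x y Ax Ay)).
by rewrite ltr_pdivrMr// ltr_pMr// ltr1n.
Qed.

Lemma connected_setT_pairwise (T : topologicalType) :
  (forall x y : T, exists A : set T, [/\ connected A, A x & A y]) ->
  connected [set: T].
Proof.
move=> TA; have [->|/set0P[x _]] := eqVneq [set: T] set0;
  first exact: connected0.
suff -> : [set: T] = connected_component setT x by exact: component_connected.
apply/seteqP; split=> // y _; have [A [cA Ax Ay]] := TA x y.
by exists A.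
Qed.

Lemma not_totally_bounded_separated X : ~ totally_bounded X ->
  exists e, 0 < e /\ exists a : nat -> X,
    forall i j, i != j -> e <= mdist (a i) (a j).
Proof.
move=> /existsNP[e /not_implyP[e0 XF]]; exists e; split=> //.
have next (s : seq X) : exists y, forall x, x \in s -> e <= mdist x y.
  apply: contrapT => /forallNP sy; apply: XF; exists [set` s] => //.
  apply/seteqP; split=> // y _; have /existsNP[x /not_implyP[xs /negP]] := sy y.
  by rewrite -ltNge => xy; exists x => //; rewrite ballEmdist.
have [g gP] := choice next.
(* [s n] lists [a 0 .. a (n - 1)], and [g] returns a point far from a list. *)
pose s := fix s n := if n is m.+1 then g (s m) :: s m else [::].
have sub m n : (m < n)%N -> g (s m) \in s n.
  elim: n => // n IH; rewrite ltnS leq_eqVlt => /predU1P[->|/IH] /=.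
    exact: mem_head.
  by rewrite inE => ->; rewrite orbT.
exists (g \o s) => i j; rewrite neq_ltn => /orP[ij|ji].
  exact/gP/sub.
by rewrite metric_sym; exact/gP/sub.
Qed.

Lemma closed_mdist_ge X (a : X) e : closed [set u | e <= mdist u a].
Proof.
rewrite -openC openE => u /= /negP; rewrite -ltNge => ua; apply/nbhs_ballP.
exists (e - mdist u a) => /=; first by rewrite subr_gt0.
move=> v; rewrite ballEmdist/= ltrBrDr => uv; apply/negP; rewrite -ltNge.
by apply: le_lt_trans uv; rewrite [mdist u v]metric_sym metric_triangle.
Qed.

(** The function [h] is the distance to the range of [a]. *)
Lemma exists_dist_range X (a : nat -> X) : exists h : X -> R,
  [/\ forall u v, h u - h v <= mdist u v, forall j, h (a j) = 0 &
      forall u e, (forall j, e <= mdist u (a j)) -> e <= h u].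
Proof.
pose h u := inf [set mdist u (a j) | j in [set: nat]].
have h_le u j : h u <= mdist u (a j).
  by apply: ge_inf; [exists 0 => _ [i _ <-]; exact: mdist_ge0|exists j].
have h_ge u e : (forall j, e <= mdist u (a j)) -> e <= h u.
  move=> eu; apply: lb_le_inf; first by exists (mdist u (a 0%N)), 0%N.
  by move=> _ [j _ <-].
exists h; split=> // [u v|j].
  rewrite lerBlDr -lerBlDl; apply: h_ge => j; rewrite lerBlDl.
  by apply: (le_trans (h_le u j)); exact: metric_triangle.
apply/eqP; rewrite eq_le h_ge ?andbT => [|i]; last exact: mdist_ge0.
by rewrite -(mdistxx (a j)) h_le.
Qed.

Lemma not_connected_clopen (T : topologicalType) : ~ connected [set: T] ->
  exists D : set T, [/\ open D, closed D, D !=set0 & ~` D !=set0].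
Proof.
move=> ncT; apply: contrapT => /forallNP nD; apply: ncT.
move=> B B0 [U oU]; rewrite setTI => BU [V cV]; rewrite setTI => BV.
apply: contrapT => BT; apply: (nD B); split=> //;
  [by rewrite BU|by rewrite BV|].
by apply/set0P/eqP; rewrite -setCT => /setC_inj.
Qed.

(** An ultrafilter sees a single piece of a finite cover: this is how total
    boundedness turns an ultrafilter into a Cauchy one. *)
Lemma ultra_bigcup_finite (T : Type) (I : choiceType) (G : set_system T)
    (F : set I) (B : I -> set T) :
  UltraFilter G -> finite_set F -> G (\bigcup_(i in F) B i) ->
  exists2 i, F i & G (B i).
Proof.
move=> GU /finite_fsetP[D ->] GB; apply: contrapT => /forall2NP nGB.
have GC i : i \in D -> G (~` B i).
  move=> iD; have [nD|nGi] := nGB i; first by case: nD.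
  by have [] := in_ultra_setVsetC (B i) GU.
have GB0 : G (\bigcup_(i in [set` D]) B i `&` \bigcap_(i in [set` D]) ~` B i).
  by apply: filterI GB _; exact: filter_bigI.
by have [t [[i Di Bi] /(_ i Di)]] := filter_ex GB0.
Qed.

End metric_spaces.

(** * Metric and connected boxes of a countable product *)

Lemma finite_set_nat_bounded (A : set nat) :
  finite_set A -> exists N, forall n, (N <= n)%N -> ~ A n.
Proof.
move=> /finite_fsetP[D ->]; exists (\max_(i <- D) i).+1 => n /= Nn nD.
by move: Nn; rewrite ltnNge leq_bigmax_seq.
Qed.

Lemma exists_tail_lt (R : realType) (e : R) : 0 < e ->
  exists N, 2 * 2^-1 ^+ N < e :> R.
Proof.
move=> e0.
have h1 : `|2^-1 : R| < 1 by rewrite ger0_norm// invf_lt1// ltr1n.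
have /cvgrPdist_lt/(_ e e0)[N _ /(_ N (leqnn N))] := cvg_geometric 2 h1.
by rewrite /= sub0r normrN ger0_norm; [exists N|rewrite mulr_ge0 ?exprn_ge0].
Qed.

Section product_metric.
Context {R : realType} {X : nat -> metricType R}.
Context (X1 : forall n (x y : X n), mdist x y <= 1).
Local Notation P := (metric_prod X1).
Implicit Types x y z : P.

Lemma coord_le_mdist_prod x y n : 2^-1 ^+ n * mdist (x n) (y n) <= mdist x y.
Proof.
pose u n := 2^-1 ^+ n * mdist (x n) (y n).
have u0 k : 0 <= u k by rewrite mulr_ge0 ?mdist_ge0 ?exprn_ge0.
rewrite mdist_prodE; apply: (@le_trans _ _ (series u n.+1)).
  by rewrite /series/= big_nat_recr//= lerDr sumr_ge0// => i _; exact: u0.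
apply: nondecreasing_cvgn_le; last exact: is_cvg_prod_mdist.
by apply/nondecreasing_seqP => m; rewrite /series/= big_nat_recr//= lerDl u0.
Qed.

(** The first [N] terms of the series contribute at most [2 * c]; the factors
    having diameter at most 1, the tail contributes at most [2 * 2^-N]. *)
Lemma mdist_prod_le x y (c : R) N : 0 <= c ->
  (forall n, (n < N)%N -> mdist (x n) (y n) <= c) ->
  mdist x y <= 2 * c + 2 * 2^-1 ^+ N.
Proof.
move=> c0 xyc; rewrite mdist_prodE.
pose S m := \sum_(0 <= n < m) 2^-1 ^+ n * mdist (x n) (y n).
have halfS m : 2^-1 ^+ m = 2 * 2^-1 ^+ m.+1 :> R.
  by rewrite exprS mulrA divff// mul1r.
have half_ge0 m : 0 <= 2^-1 ^+ m :> R by rewrite exprn_ge0.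
have SS m : S m.+1 = S m + 2^-1 ^+ m * mdist (x m) (y m).
  by rewrite /S big_nat_recr.
(* Adding the geometric remainder to the partial sums makes both bounds
   inductive; [head] covers the indices below [N] and [tail] the others. *)
have head m : (m <= N)%N -> S m + 2 * c * 2^-1 ^+ m <= 2 * c.
  elim: m => [_|m IH mN]; first by rewrite /S big_nil expr0; lra.
  have := ler_wpM2l (half_ge0 m) (xyc _ mN); have := IH (ltnW mN).
  rewrite SS (halfS m); nra.
have tail p : S (N + p)%N + 2 * 2^-1 ^+ (N + p) <= 2 * c + 2 * 2^-1 ^+ N.
  elim: p => [|p IH].
    rewrite addn0; have := head N (leqnn _); have := mulr_ge0 c0 (half_ge0 N).
    lra.
  have := ler_wpM2l (half_ge0 (N + p)%N) (X1 (x (N + p)%N) (y (N + p)%N)).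
  by rewrite addnS SS; move: IH; rewrite (halfS (N + p)%N); lra.
apply: limr_le; first exact: is_cvg_prod_mdist.
near=> m; have Nm : (N <= m)%N by near: m; exact: nbhs_infty_ge.
have := tail (m - N)%N; rewrite subnKC// => tm.
change (S m <= 2 * c + 2 * 2^-1 ^+ N).
by apply: le_trans tm; rewrite lerDl mulr_ge0.
Unshelve. all: by end_near. Qed.

Lemma mdist_prod_agree x y N :
  (forall n, (n < N)%N -> x n = y n) -> mdist x y <= 2 * 2^-1 ^+ N.
Proof.
move=> xy; have := @mdist_prod_le x y 0 N (lexx _).
by rewrite mulr0 add0r; apply => n /xy ->; rewrite mdistxx.
Qed.

Lemma mdist_prod_close (r : nat -> R) M : (forall n, 0 < r n) ->
  exists2 d, 0 < d & forall x y, mdist x y < d ->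
    forall n, (n < M)%N -> mdist (x n) (y n) < r n.
Proof.
move=> r0; elim: M => [|M [d d0 IH]]; first by exists 1.
exists (Order.min d (2^-1 ^+ M * r M)).
  by rewrite lt_min d0 mulr_gt0// exprn_gt0.
move=> x y; rewrite lt_min => /andP[/IH{}IH xyM] n.
rewrite ltnS leq_eqVlt => /predU1P[->|/IH//].
have := le_lt_trans (coord_le_mdist_prod x y M) xyM.
by rewrite ltr_pM2l// exprn_gt0.
Qed.

Lemma continuous_coord n : continuous (fun x : P => x n).
Proof.
apply: continuous_metric => x e e0.
exists (2^-1 ^+ n * e); first by rewrite mulr_gt0// exprn_gt0.
move=> y /(le_lt_trans (coord_le_mdist_prod x y n)).
by rewrite ltr_pM2l// exprn_gt0.
Qed.

Definition slice (z : P) n (a : X n) : P := dfwith (z : forall n, X n) n a.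
Arguments slice : clear implicits.

Lemma slice_in z n a : slice z n a n = a. Proof. exact: dfwithin. Qed.

Lemma slice_out z n a m : n != m -> slice z n a m = z m.
Proof. exact: dfwithout. Qed.

Lemma slice_id z n : slice z n (z n) = z.
Proof.
apply: functional_extensionality_dep => m.
by have [<-|nm] := eqVneq n m; [rewrite slice_in|rewrite slice_out].
Qed.

Lemma mdist_slice z n (a b : X n) :
  mdist (slice z n a) (slice z n b) <= 2 * mdist a b.
Proof.
apply/ler_addgt0Pr => e /exists_tail_lt[N Ne].
apply: (@le_trans _ _ (2 * mdist a b + 2 * 2^-1 ^+ N));
  last by rewrite lerD2l ltW.
apply: mdist_prod_le => [|m _]; first exact: mdist_ge0.
have [<-|nm] := eqVneq n m; first by rewrite !slice_in.
by rewrite !slice_out// mdistxx mdist_ge0.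
Qed.

Lemma continuous_slice z n : continuous (slice z n).
Proof.
apply: continuous_metric => a e e0.
exists (e / 2); first by rewrite divr_gt0.
move=> b ab; apply: (le_lt_trans (mdist_slice z a b)).
by rewrite mulrC -ltr_pdivlMr.
Qed.

(** A nonempty relatively clopen subset [B] of the box is stable under changing
    one coordinate within the box, as slices of the box are connected, hence
    under changing finitely many; such changes of a given point of [B] are dense
    in the box and [B] is closed. *)
Lemma connected_box (A : forall n, set (X n)) : (forall n, connected (A n)) ->
  connected [set x : P | forall n, A n (x n)].
Proof.
move=> cA B [x Bx] [U oU BU] [V cV BV].
apply/seteqP; split; first by rewrite BU => y [].
have step z n a : B z -> A n a -> B (slice z n a).
  move=> Bz Aa.
  have Az : forall m, A m (z m) by move: Bz; rewrite BU => -[].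
  have boxP b : A n b -> forall m, A m (slice z n b m).
    move=> Ab m; have [<-|nm] := eqVneq n m; first by rewrite slice_in.
    by rewrite slice_out.
  have cs := @continuous_slice z n.
  suff : A n `&` (slice z n @^-1` B) = A n by move=> /seteqP[_ /(_ a Aa)[]].
  apply: (cA n).
  - by exists (z n); split=> //=; rewrite slice_id.
  - exists (slice z n @^-1` U); first by move/continuousP : cs; exact.
    rewrite BU; apply/seteqP; split=> b [Ab /=]; first by case.
    by move=> Ub; split=> //=; split=> //; exact: boxP.
  - exists (slice z n @^-1` V); first by move/continuous_closedP : cs; exact.
    rewrite BV; apply/seteqP; split=> b [Ab /=]; first by case.
    by move=> Vb; split=> //=; split=> //; exact: boxP.
move=> y Ay.
(* [w k] agrees with [y] before [k] and with the point [x] of [B] afterwards. *)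
pose w k : P := fun n => if (n < k)%N then y n else x n.
have Bw k : B (w k).
  elim: k => [|k IH].
    by rewrite (_ : w 0%N = x)//; apply: functional_extensionality_dep.
  suff -> : w k.+1 = slice (w k) k (y k) by apply: step.
  apply: functional_extensionality_dep => n.
  have [<-|kn] := eqVneq k n; first by rewrite slice_in /w ltnSn.
  by rewrite slice_out// /w ltnS leq_eqVlt eq_sym (negbTE kn).
rewrite BV; split=> //.
apply: (@closed_cvg _ _ \oo _ w V cV) => //.
  by apply: nearW => k; have := Bw k; rewrite BV => -[].
apply/cvg_ballP => e e0; have [N Ne] := exists_tail_lt e0.
near=> k; rewrite ballEmdist/=; apply: le_lt_trans Ne.
apply: mdist_prod_agree => n nN; rewrite /w (leq_trans nN)//.
by near: k; exact: nbhs_infty_ge.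
Unshelve. all: by end_near. Qed.

(** Shared by the local connectedness of the product, where the second
    alternative is used for all large [n], and by the totally bounded case,
    where the two points agree at all large [n] and the first one suffices. *)
Lemma prod_ulc_box (e : R) : (forall n, ulc (X n)) -> 0 < e ->
  exists N (r : nat -> R), (forall n, 0 < r n) /\
    forall x y,
      (forall n, mdist (x n) (y n) < r n \/
                 (N <= n)%N /\ connected [set: X n]) ->
      exists A : set P, [/\ connected A, A x, A y &
        forall u v, A u -> A v -> mdist u v < e].
Proof.
move=> X_ulc e0; have e8 : 0 < e / 8 by rewrite divr_gt0.
have e2 : 0 < e / 2 by rewrite divr_gt0.
have [N Ne] := exists_tail_lt e2.
have rP n : exists r, 0 < r /\ forall a b : X n, mdist a b < r ->
    exists A : set (X n), [/\ connected A, A a, A b &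
      forall u v, A u -> A v -> mdist u v < e / 8].
  by have [r r0 rA] := ulcP (X_ulc n) e8; exists r.
have [r {}rP] := choice rP.
exists N, r; split=> [n|x y xy]; first exact: (rP n).1.
have AP n : exists A : set (X n), [/\ connected A, A (x n), A (y n) &
    (n < N)%N -> forall u v, A u -> A v -> mdist u v < e / 8].
  have [/(rP n).2[A [cA Ax Ay Ae]]|[Nn cX]] := xy n; first by exists A.
  by exists setT; split=> //; rewrite ltnNge Nn.
pose A n := sval (cid (AP n)).
have AnP n : [/\ connected (A n), A n (x n), A n (y n) &
    (n < N)%N -> forall u v, A n u -> A n v -> mdist u v < e / 8].
  exact: (svalP (cid (AP n))).
exists [set z | forall n, A n (z n)]; split.
- by apply: connected_box => n; case: (AnP n).
- by move=> n; case: (AnP n).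
- by move=> n; case: (AnP n).
- move=> u v Au Av; apply: (@le_lt_trans _ _ (2 * (e / 8) + 2 * 2^-1 ^+ N)).
    apply: mdist_prod_le => [|n nN]; first exact: ltW.
    by have [_ _ _ /(_ nN) Ae] := AnP n; rewrite ltW// Ae.
  move: Ne; lra.
Qed.

Lemma ulc_prod : (forall n, ulc (X n)) ->
  finite_set [set n | ~ connected [set: X n]] -> ulc P.
Proof.
move=> X_ulc /finite_set_nat_bounded[M cX] e e0.
have e2 : 0 < e / 2 by rewrite divr_gt0.
have [N [r [r0 box]]] := prod_ulc_box X_ulc e2.
have [d d0 dr] := mdist_prod_close (maxn M N) r0.
exists d => // x y /dr xy; have [n|A [cA Ax Ay Ae]] := box x y.
  have [/xy|] := ltnP n (maxn M N); first by left.
  by rewrite geq_max => /andP[/cX/contrapT]; right.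
exists A; split=> //; apply: (@le_lt_trans _ _ (e / 2)%:E).
  by apply: diameter_le => u v Au Av; rewrite ltW// Ae.
by rewrite lte_fin; lra.
Qed.

(** Two points differing only in coordinate [n] are within [2 * 2^-n] of each
    other, so a connected set joins them, and so does its projection. *)
Lemma ulc_prod_connected : (forall n, [set: X n] !=set0) -> ulc P ->
  finite_set [set n | ~ connected [set: X n]].
Proof.
move=> X_nonempty /ulcP/(_ 1 ltr01)[d d0 uP]; have [N Nd] := exists_tail_lt d0.
apply: (@sub_finite_set _ _ `I_N); last exact: finite_II.
pose base : P := fun n => projT1 (cid (X_nonempty n)).
move=> n /= ncX; rewrite ltnNge; apply/negP => Nn; apply: ncX.
apply: connected_setT_pairwise => a b.
have [|A [cA Aa Ab _]] := uP (slice base n a) (slice base n b).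
  apply: le_lt_trans Nd; apply: mdist_prod_agree => m mN.
  by rewrite !slice_out// gtn_eqF// (leq_trans mN).
exists ((fun x : P => x n) @` A); split.
- apply: connected_continuous_connected => //.
  exact/continuous_subspaceT/continuous_coord.
- by exists (slice base n a) => //; rewrite slice_in.
- by exists (slice base n b) => //; rewrite slice_in.
Qed.
End product_metric.
Arguments slice {R X X1} z n a.

(** * Straightness of a countable product *)

Section straight_products.
Context {R : realType} {X : nat -> metricType R}.
Context (X1 : forall n (x y : X n), mdist x y <= 1).
Local Notation P := (metric_prod X1).
Implicit Types x y z : P.

(** The precision [r] on each coordinate is fixed by the required oscillation
    of [f] alone; the number [M] of coordinates to control is chosen afterwards,
    from the continuity of [f] at the point [q] that depends on [r]. *)
Lemma totally_bounded_straight_prod :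
  (forall n, ulc (X n)) -> (forall n, totally_bounded (X n)) -> straight P.
Proof.
move=> X_ulc X_tb k C _ CX f cf.
split=> [uf i|uf]; first exact: unif_continuous_sigL.
apply: contrapT => /unif_continuous_metricP/existsNP[e /not_implyP[e0 nuf]].
pose bad d := [set z : P * P | mdist z.1 z.2 < d /\ e <= `|f z.1 - f z.2|].
have badF : ProperFilter (filter_from [set d | 0 < d] bad).
  apply: filter_from_proper.
    apply: filter_from_filter; first by exists 1 => /=.
    move=> d d' /= d0 d'0; exists (Order.min d d'); first by rewrite lt_min d0.
    by move=> z [/=]; rewrite lt_min => /andP[? ?] ?.
  move=> d /= d0; apply: contrapT => /forallNP nbad; apply: nuf.
  exists d => // x y xy; rewrite ltNge; apply/negP => exy.
  exact: (nbad (x, y)).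
have [G [GU badG]] := ultraFilterLemma badF.
have e4 : 0 < e / 4 by rewrite divr_gt0.
have [h h0 fh] := piecewise_small_osc cf CX uf e4.
have [N [r [r0 box]]] := prod_ulc_box X1 X_ulc h0.
have r20 n : 0 < r n / 2 by rewrite divr_gt0.
have qP n : exists q, G [set z : P * P | mdist q (z.1 n) < r n / 2].
  have [F finF FX] := X_tb n _ (r20 n).
  have [|q _ Gq] := @ultra_bigcup_finite _ _ G F
    (fun q => [set z : P * P | mdist q (z.1 n) < r n / 2]) GU finF.
    apply: filterS filterT => z _.
    have [q Fq] : (\bigcup_(q in F) ball q (r n / 2)) (z.1 n) by rewrite FX.
    by rewrite ballEmdist; exists q.
  by exists q.
(* The ultrafilter is Cauchy in each coordinate; [q] is a substitute for its
   limit, which may not exist, at a precision [r n / 2] fixed in advance. *)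
pose q : P := fun n => projT1 (cid (qP n)).
have GqP n : G [set z : P * P | mdist (q n) (z.1 n) < r n / 2].
  exact: (projT2 (cid (qP n))).
have [d d0 fd] : exists2 d, 0 < d &
    forall y, mdist q y < d -> `|f q - f y| < e / 4.
  have /cvg_ballP/(_ _ e4) := cf q.
  by move=> /nbhs_ballP[d d0 fd]; exists d => // y qy; apply: fd;
    rewrite ballEmdist.
have [M Md] := exists_tail_lt d0.
have near_q y : (forall n, (n < M)%N -> mdist (q n) (y n) < r n) ->
    `|f q - f y| < e / 2.
  (* [z] is close to [q], and in a small connected box with [y]. *)
  move=> qy; pose z : P := fun n => if (n < M)%N then q n else y n.
  have qz : `|f q - f z| < e / 4.
    apply: fd; apply: le_lt_trans Md; apply: mdist_prod_agree => n nM.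
    by rewrite /z nM.
  have [n|A [cA Az Ay Ah]] := box z y.
    by left; rewrite /z; case: ifP => [/qy//|_]; rewrite mdistxx.
  have zy := fh A cA Ah z y Az Ay.
  have := ler_distD (f z) (f q) (f y); lra.
have [d' d'0 close] := mdist_prod_close X1 M r20.
have Gq : G [set z : P * P | forall n : 'I_M, mdist (q n) (z.1 n) < r n / 2].
  apply: (@filter_forall _ _
    (fun (n : 'I_M) (z : P * P) => mdist (q n) (z.1 n) < r n / 2)).
  by move=> n; exact: GqP.
have Gbad : G (bad d') by apply: badG; exists d'.
have [[x y] [/= qx [/= /close xy exy]]] := filter_ex (filterI Gq Gbad).
have qx' n : (n < M)%N -> mdist (q n) (x n) < r n / 2.
  by move=> nM; exact: (qx (Ordinal nM)).
have fx : `|f q - f x| < e / 2.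
  by apply: near_q => n /qx' /lt_trans; apply; have := r0 n; lra.
have fy : `|f q - f y| < e / 2.
  apply: near_q => n nM; apply: (le_lt_trans (metric_triangle _ (x n) _)).
  by rewrite [r n]splitr ltrD ?qx' ?xy.
have := ler_distD (f q) (f x) (f y); rewrite (distrC (f x) (f q)).
move: exy => /=; lra.
Qed.

(** A witness needs, for every [j], a pair of points at distance about [2^-j]
    on which the function differs by a fixed amount, and the pairs for different
    [j] must not interfere.  The clopen splittings of infinitely many factors
    give the pairs; the separated sequence in [X n0] provides disjoint regions of
    uniform size in which to place them. *)
Lemma not_straight_prod n0 :
  (forall n, [set: X n] !=set0) ->
  ~ finite_set [set n | ~ connected [set: X n]] ->
  ~ totally_bounded (X n0) -> ~ straight P.
Proof.
move=> X_ne Xinf /not_totally_bounded_separated[e [e0 [a ea]]] sP.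
pose base : P := fun n => projT1 (cid (X_ne n)).
(* The index [n j] exceeds [n0], so that the coordinate being split is not the
   one carrying the separated sequence. *)
have nP j : exists n, [/\ (j < n)%N, (n0 < n)%N & ~ connected [set: X n]].
  apply: contrapT => /forallNP nj; apply: Xinf.
  apply: (@sub_finite_set _ _ `I_(maxn j n0).+1); last exact: finite_II.
  move=> n /= ncX; rewrite ltnS leqNgt gtn_max; apply/negP => /andP[jn n0n].
  exact: (nj n).
have [n {}nP] := choice nP.
have DP j : exists D : set (X (n j)),
    [/\ open D, closed D, D !=set0 & ~` D !=set0].
  by have [_ _ ncX] := nP j; exact: not_connected_clopen.
pose D j := projT1 (cid (DP j)).
have clopenD j : [/\ open (D j), closed (D j), D j !=set0 & ~` D j !=set0].
  exact: (projT2 (cid (DP j))).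
pose r := e / 2.
have r0 : 0 < r by rewrite divr_gt0.
have uniq_near (u : X n0) i j : mdist u (a i) < r -> mdist u (a j) < r -> i = j.
  move=> ui uj; apply/eqP; apply: contraT => /ea; rewrite leNgt => /negP; case.
  apply: (le_lt_trans (metric_triangle _ u _)); rewrite [e]splitr.
  by rewrite ltrD// metric_sym.
(* By [uniq_near] each point is subject to at most one of the constraints
   below, hence lies in [C1] or [C2]. *)
pose C1 := [set x : P | forall j, mdist (x n0) (a j) < r -> D j (x (n j))].
pose C2 := [set x : P | forall j, mdist (x n0) (a j) < r -> ~ D j (x (n j))].
have closedC (E : forall j, set (X (n j))) : (forall j, closed (E j)) ->
    closed [set x : P | forall j, mdist (x n0) (a j) < r -> E j (x (n j))].
  move=> cE; rewrite (_ : [set x | _] = \bigcap_j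
    ((fun x : P => x n0) @^-1` [set u | r <= mdist u (a j)] `|`
     (fun x : P => x (n j)) @^-1` E j)).
    apply: closed_bigI => j _; apply: closedU.
      have /continuous_closedP := @continuous_coord _ _ X1 n0; apply.
      exact: closed_mdist_ge.
    by have /continuous_closedP := @continuous_coord _ _ X1 (n j); apply.
  apply/seteqP; split=> x Ex j; last by rewrite ltNge => /negP; case: (Ex j I).
  move=> _ /=; have [|xa] := leP r (mdist (x n0) (a j)); first by left.
  by right; exact: Ex.
have cC1 : closed C1 by apply: closedC => j; case: (clopenD j).
have cC2 : closed C2.
  by apply: (closedC (fun j => ~` D j)) => j;
    apply: open_closedC; case: (clopenD j).
have C12 : C1 `|` C2 = setT.
  apply/seteqP; split=> // x _.
  have [|/forallNP xa] := pselect (exists j, mdist (x n0) (a j) < r).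
    move=> [j xj]; have [Dx|nDx] := pselect (D j (x (n j))).
      by left => i xi; rewrite (uniq_near _ _ _ xi xj).
    by right => i xi; rewrite (uniq_near _ _ _ xi xj).
  by left => j /xa.
have [h [h_lip h0 h_ge]] := exists_dist_range a.
(* On [C1] the function is the distance of [x n0] to the sequence, truncated at
   [r]; on the overlap of [C1] and [C2] that distance is at least [r], so both
   formulas agree. *)
pose f x := if pselect (C1 x) then Order.min (h (x n0)) r else r.
have f1 x : C1 x -> f x = Order.min (h (x n0)) r by rewrite /f; case: pselect.
have f2 x : C2 x -> f x = r.
  rewrite /f; case: pselect => // C1x C2x; apply/min_idPr; apply: h_ge => j.
  by rewrite leNgt; apply/negP => xj; apply: (C2x _ xj); exact: C1x.
have uf1 : unif_continuous (sigL C1 f).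
  apply/unif_continuous_sigLP => b b0.
  have [d d0 dP] := mdist_prod_close X1 n0.+1 (fun=> b0).
  exists d => // x y C1x C1y xy; rewrite !f1//.
  apply: le_lt_trans (dP x y xy n0 (ltnSn _)).
  have := h_lip (x n0) (y n0); have := h_lip (y n0) (x n0).
  rewrite (metric_sym (y n0)) ler_norml.
  move=> yx xy'; apply/andP; split;
    by case: (leP (h (x n0)) r) => ?; case: (leP (h (y n0)) r) => ?; lra.
have uf2 : unif_continuous (sigL C2 f).
  apply/unif_continuous_sigLP => b b0; exists 1 => // x y C2x C2y _.
  by rewrite !f2// subrr normr0.
have cf : continuous f.
  apply/continuous_subspace_setT; rewrite -C12.
  by apply: withinU_continuous => //; exact: unif_continuous_sigL_within.
pose C (i : 'I_2) := if i == ord0 then C1 else C2.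
have /unif_continuous_metricP/(_ r r0)[d d0 fd] : unif_continuous f.
  apply/(sP 2%N C) => //.
  - by move=> i; rewrite /C; case: ifP.
  - apply/seteqP; split=> // x _; have : (C1 `|` C2) x by rewrite C12.
    by move=> [?|?]; [exists ord0|exists ord_max].
  - by move=> i; rewrite /C; case: ifP.
have [j jd] := exists_tail_lt d0.
have [jn n0n _] := nP j; have [_ _ [u Du] [v Dv]] := clopenD j.
(* Two points over [a j], on either side of the splitting of [X (n j)]: [f] is 0
   at the first one and [r] at the second one. *)
pose p := slice base n0 (a j).
have pn0 b : (slice p (n j) b : P) n0 = a j.
  by rewrite slice_out ?gtn_eqF// /p slice_in.
have C1u : C1 (slice p (n j) u).
  move=> i; rewrite pn0 => ji; have <- : j = i; last by rewrite slice_in.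
  by apply: (uniq_near (a j)) => //; rewrite mdistxx.
have C2v : C2 (slice p (n j) v).
  move=> i; rewrite pn0 => ji; have <- : j = i; last by rewrite slice_in.
  by apply: (uniq_near (a j)) => //; rewrite mdistxx.
have := fd (slice p (n j) u) (slice p (n j) v).
rewrite f1// f2// pn0 h0.
rewrite (min_idPl (ltW r0)) sub0r normrN gtr0_norm// ltxx => abs.
suff : false by [].
apply: abs; apply: le_lt_trans jd; apply: mdist_prod_agree => m mj.
by rewrite !slice_out// gtn_eqF// (ltn_trans mj).
Qed.
End straight_products.

Theorem theoremB (R : realType) (X : nat -> metricType R)
  (X1 : forall n (x y : X n), mdist x y <= 1)
  (X_nonempty : forall n, [set: X n] !=set0)
  (X_ulc : forall n, ulc (X n)) :
  (ulc (metric_prod X1) <->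
    finite_set [set n | ~ connected [set: X n]]) /\
  (straight (metric_prod X1) <->
    (ulc (metric_prod X1) \/ forall n, totally_bounded (X n))).
Proof.
have ulcE : ulc (metric_prod X1) <->
    finite_set [set n | ~ connected [set: X n]].
  by split; [exact: ulc_prod_connected|exact: ulc_prod].
split=> //; split=> [sX|[|]]; last 2 first.
- exact: ulc_straight.
- exact: totally_bounded_straight_prod.
have [|nulc] := pselect (ulc (metric_prod X1)); first by left.
right=> n; apply: contrapT => ntb; apply: (not_straight_prod _ _ ntb sX) => //.
by move=> /ulcE.
Qed.
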